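(* Let $\eta$ be an $\mathbb{N}$-valued random variable with $\mathbf{P}[\eta\ge1]>0$. Suppose that $\mathcal{G}$ is an infinite connected undirected graph of maximum degree $k$ and that $\mathbf{E}\,\eta<\infty$. Then \[ p_c(\mathcal{G},\eta)\ge\frac{k}{1+(k-1)(\mathbf{E}\,\eta+1)}. \]
   Context: Here $\mathbb{N}=\{0,1,2,\dots\}$. Frog model $\mathrm{FM}(\mathcal{G},p,\eta)$. Let $\mathcal{G}$ be an infinite connected undirected graph all of whose sites (vertices) have finite degree, with a fixed site $\mathbf{0}$ called the root; let $p\in[0,1]$ and let $\eta$ be a random variable with values in $\mathbb{N}$. Let $\{\eta(x)\}_{x}$, $\{(S^x_n(i))_{n\in\mathbb{N}}\}_{x,\,i\ge1}$, $\{\Xi^x_p(i)\}_{x,\,i\ge 1}$ be independent families of independent random variables, where $\eta(x)$ has the law of $\eta$, $(S^x_n(i))_n$ is a discrete-time simple random walk on $\mathcal{G}$ started from $x$, and $\mathbf{P}[\Xi^x_p(i)=k]=(1-p)p^{k-1}$, $k=1,2,\dots$ (for $p=1$, $\Xi^x_p(i)=\infty$, no death). Site $x$ initially contains $\eta(x)$ particles; at time $0$ all particles are sleeping except those at the root, which are active. If the particles of site $x$ are activated at time $T(x)$, the $i$-th of them ($1\le i\le\eta(x)$) is active and located at $S^x_n(i)$ at time $T(x)+n$ for $0\le n<\Xi^x_p(i)$, and then disappears. When an active particle visits a site, all sleeping particles there become active. Formally, $t(x,y)=\min_{1\le i\le\eta(x)}\min\{n<\Xi^x_p(i):S^x_n(i)=y\}$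 for $x\ne y$ ($\infty$ if there is no such $n$), and $T(x)=\inf\{t(x_0,x_1)+\dots+t(x_{m-1},x_m)\}$ over all finite sequences $\mathbf{0}=x_0,x_1,\dots,x_m=x$, with $T(\mathbf{0})=0$; $T(x)=\infty$ means that $x$ is never visited by active particles. The model survives if at every time there is at least one active particle; otherwise it dies out. The critical parameter is $p_c(\mathcal{G},\eta)=\inf\{p\in[0,1]:\mathbf{P}[\mathrm{FM}(\mathcal{G},p,\eta)\text{ survives}]>0\}$. *)

(* Defs.v *)
From HB Require Import structures.
From mathcomp Require Import all_boot all_order all_algebra finmap.
From mathcomp Require Import all_classical all_reals all_analysis measurable_realfun.

Set Implicit Arguments.
Unset Strict Implicit.
Unset Printing Implicit Defensive.

Import Order.TTheory GRing.Theory Num.Theory.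
Local Open Scope classical_set_scope.
Local Open Scope ring_scope.

Record graph (V : choiceType) := Graph {
  adj : rel V;
  adj_sym : symmetric adj;
  adj_irr : irreflexive adj }.

Definition neighbours (V : choiceType) (G : graph V) (x : V) : set V :=
  [set y | adj G x y].

Definition locally_finite (V : choiceType) (G : graph V) : Prop :=
  forall x, finite_set (neighbours G x).

Definition connected_graph (V : choiceType) (G : graph V) : Prop :=
  forall x y, exists s : seq V, path (adj G) x s /\ last x s = y.

(* [fset_set] is [fset0] on infinite sets, so this is meaningful only under
   [locally_finite G]. *)
Definition degree (V : choiceType) (G : graph V) (x : V) : nat :=
  #|` fset_set (neighbours G x)|%fset.

Definition max_degree (V : choiceType) (G : graph V) (k : nat) : Prop :=
  (forall x, (degree G x <= k)%N) /\ (exists x, degree G x = k).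

(* Probability that the simple random walk started from x makes its first
   [size s] steps along s. *)
Fixpoint srw_path (R : realType) (V : choiceType) (G : graph V)
    (x : V) (s : seq V) : R :=
  if s is y :: s' then
    (if adj G x y then (degree G x)%:R^-1 else 0) * srw_path R G y s'
  else 1.

(* The path s = [::] gives P[S_0 = x] = 1. *)
Definition is_srw (R : realType) (V : choiceType) (G : graph V)
    (d : measure_display) (T : measurableType d) (P : probability T R)
    (x : V) (S : nat -> T -> V) : Prop :=
  (forall n y, measurable [set w | S n w = y]) /\
  (forall s : seq V,
     P [set w | forall n, (n <= size s)%N -> S n w = nth x (x :: s) n]
     = (srw_path R G x s)%:E).

(* The parameter is the survival probability p per step; p = 1 gives the
   constant +oo, almost surely. *)
Definition is_lifetime (R : realType)
    (d : measure_display) (T : measurableType d) (P : probability T R)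
    (p : R) (X : T -> \bar R) : Prop :=
  [/\ measurable_fun [set: T] X,
      forall k : nat, (1 <= k)%N ->
        P [set w | X w = k%:R%:E] = ((1 - p) * p ^+ k.-1)%:E &
      p = 1 -> P [set w | X w = +oo%E] = 1%E].

Definition same_law (R : realType)
    (d : measure_display) (T : measurableType d) (P : probability T R)
    (d0 : measure_display) (T0 : measurableType d0) (P0 : probability T0 R)
    (X : T -> nat) (Y : T0 -> nat) : Prop :=
  measurable_fun [set: T] X /\
  forall A : set nat, P (X @^-1` A) = P0 (Y @^-1` A).

Definition mutually_independent (R : realType)
    (d : measure_display) (T : measurableType d) (P : probability T R)
    (I : choiceType) (F : I -> set_system T) : Prop :=
  forall (J : {fset I}) (E : I -> set T),
    (forall i, i \in J -> F i (E i)) ->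
    P (\bigcap_(i in [set` J]) E i) = (\prod_(i <- J) fine (P (E i)))%:E.

(* Particles of a site are numbered from 0: those of x at time 0 are the
   i < sleepers x, and the i-th of them corresponds to the index i + 1 in the
   usual numbering from 1. *)
Record frogs (R : realType) (V : choiceType) (T : Type) := Frogs {
  sleepers : V -> T -> nat;
  walk : V -> nat -> nat -> T -> V;
  lifetime : V -> nat -> T -> \bar R }.

(* One index per random element: the particle count of a site, the whole
   trajectory of a particle, the lifetime of a particle. *)
Definition frogs_sigma (R : realType) (V : choiceType)
    (d : measure_display) (T : measurableType d) (F : frogs R V T)
    (j : (V + (V * nat + V * nat))%type) : set_system T :=
  match j with
  | inl x => [set sleepers F x @^-1` A | A in [set: set nat]]
  | inr (inl (x, i)) =>
      <<s [set B | exists n y, B = [set w | walk F x i n w = y]] >>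
  | inr (inr (x, i)) =>
      [set lifetime F x i @^-1` A | A in (measurable : set (set (\bar R)))]
  end.

Definition is_frog_model (R : realType) (V : choiceType) (G : graph V)
    (p : R)
    (d0 : measure_display) (T0 : measurableType d0) (P0 : probability T0 R)
    (eta : T0 -> nat)
    (d : measure_display) (T : measurableType d) (P : probability T R)
    (F : frogs R V T) : Prop :=
  [/\ forall x, same_law P P0 (sleepers F x) eta,
      forall x i, is_srw G P x (walk F x i),
      forall x i, is_lifetime P p (lifetime F x i) &
      mutually_independent P (frogs_sigma F)].

Section dynamics.
Local Open Scope ereal_scope.

(* t(x, y), also given a meaning for x = y; steps with x = y have nonnegative
   length and so do not affect the infimum in [activation]. *)
Definition passage (R : realType) (V : choiceType) (T : Type)
    (F : frogs R V T) (w : T) (x y : V) : \bar R :=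
  ereal_inf [set u | exists i n : nat,
    [/\ (i < sleepers F x w)%N, n%:R%:E < lifetime F x i w,
        walk F x i n w = y & u = n%:R%:E]].

Definition activation (R : realType) (V : choiceType) (T : Type)
    (F : frogs R V T) (root : V) (w : T) (x : V) : \bar R :=
  ereal_inf [set \sum_(j < size s)
                   passage F w (nth root (root :: s) j) (nth root s j)
            | s in [set s : seq V | last root s = x]].

Definition active (R : realType) (V : choiceType) (T : Type)
    (F : frogs R V T) (root : V) (w : T) (n : nat) (x : V) (i : nat) : Prop :=
  [/\ (i < sleepers F x w)%N, activation F root w x <= n%:R%:E &
      n%:R%:E < activation F root w x + lifetime F x i w].

Definition survival (R : realType) (V : choiceType) (T : Type)
    (F : frogs R V T) (root : V) : set T :=
  [set w | forall n : nat, exists x i, active F root w n x i].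

(* P[survival] depends only on G, root, p and the law of eta, so quantifying
   existentially over realizations does not depend on the choice of one. The
   value is +oo only if no p qualifies, e.g. for eta = 0 almost surely. *)
Definition critical_parameter (R : realType) (V : choiceType) (G : graph V)
    (root : V)
    (d0 : measure_display) (T0 : measurableType d0) (P0 : probability T0 R)
    (eta : T0 -> nat) : \bar R :=
  ereal_inf [set p%:E | p in [set p : R | (0 <= p <= 1)%R /\
    exists (d : measure_display) (T : measurableType d) (P : probability T R)
           (F : frogs R V T),
      is_frog_model G p P0 eta P F /\ 0 < P (survival F root)]].

End dynamics.

(* Main.v *)
Require Import Defs.
From HB Require Import structures.
From mathcomp Require Import all_boot all_order all_algebra finmap.
From mathcomp Require Import all_classical all_reals all_analysis measurable_realfun.
From mathcomp Require Import ring.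

(* A particle that is active at time n is reached through a line of ancestors,
   hence through a path of n steps from the root along which the particle that
   is followed is sometimes replaced by one that it wakes up. A site wakes its
   particles at its first visit, so such a replacement never happens at a site
   that occurred before on the path; in particular not at the site from which
   the path just came. The particles on the path start from distinct sites and
   are therefore independent, and the probabilities of all paths add up to at
   most C r^n with
     r = p (1/k + (k-1)/k (1 + E eta)) = p (1 + (k-1) (E eta + 1)) / k,
   which tends to 0 when p is below the bound. *)

Set Implicit Arguments.
Unset Strict Implicit.
Unset Printing Implicit Defensive.

Import Order.TTheory GRing.Theory Num.Theory.
Local Open Scope classical_set_scope.
Local Open Scope ring_scope.

(** * Countability, measurability and the tail sum of an expectation *)

Lemma countable_seq (V : Type) :
  countable [set: V] -> countable [set: seq V].
Proof.
move=> /countable_injP[f inj_f]; apply/countable_injP.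
have inj_map : {in [set: seq V] &, injective (map f)}.
  move=> s t _ _; elim: s t => [|x s IH] [|y t] //= [fxy /IH ->].
  by rewrite (inj_f x y) ?in_setT.
exists (choice.pickle \o map f) => s t sV tV /= /(pcan_inj choice.pickleK).
exact: inj_map.
Qed.

Section measurability.
Context d (T : measurableType d) (R : realType) (I : Type).
Hypothesis cI : countable [set: I].

(** An infimum lies strictly below [c] exactly when some member does, so its strict sublevel sets
    are countable unions. The index set [D w] may be random, which is why membership in it enters
    the hypothesis. *)
Lemma measurable_fun_einf (D : T -> set I) (v : I -> T -> \bar R) :
  (forall j (c : R), measurable [set w | D w j /\ (v j w < c%:E)%E]) ->
  measurable_fun [set: T] (fun w => ereal_inf [set v j w | j in D w]).
Proof.
move=> mDv.
apply: (measurability _ (ErealGenInftyO.measurableE R)) => _ [_ [c ->] <-].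
rewrite setTI; suff -> : (fun w => ereal_inf [set v j w | j in D w]) @^-1`
    `]-oo, c%:E[ = \bigcup_j [set w | D w j /\ (v j w < c%:E)%E].
  exact: countable_bigcupT_measurable.
apply/seteqP; split=> [w|w [j _ [Dj vj]]] /=; rewrite in_itv /=.
- by move=> /ereal_inf_lt[_ [j Dj <-] vj]; exists j.
- by apply: le_lt_trans vj; apply: ereal_inf_lbound; exists j.
Qed.

(** Reindexing along an injection into the naturals, each [G n] is empty or a single [F i], so
    sigma-subadditivity applies. *)
Lemma bigcup_null (P : probability T R) (F : I -> set T) :
  (forall i, measurable (F i)) -> (forall i, P (F i) = 0%E) ->
  P (\bigcup_i F i) = 0%E.
Proof.
move=> mF PF0; have /countable_injP[f inj_f] := cI.
have mU : measurable (\bigcup_i F i) by exact: countable_bigcupT_measurable.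
apply/eqP; rewrite -measure_le0 //.
pose G n := \bigcup_(i in [set i | f i = n]) F i.
have GE n : G n = set0 \/ exists i, G n = F i.
  have [[i fi]|nf] := pselect (exists i, f i = n); last first.
    by left; rewrite -subset0 => w [i fi _]; apply: nf; exists i.
  right; exists i; apply/seteqP; split=> [w [j fj]|w Fw]; last by exists i.
  by rewrite (inj_f i j) ?in_setT ?fi.
have mG n : measurable (G n) by have [->|[i ->]] := GE n.
apply: (@le_trans _ _ (\sum_(0 <= n <oo) P (G n))%E).
  by apply: measure_sigma_subadditive => // w [i _ Fw]; exists (f i) => //; exists i.
by rewrite eseries0 // => n _ _; have [->|[i ->]] := GE n; rewrite ?measure0.
Qed.

End measurability.

(** The spheres of endpoints of [n]-step paths from the root are finite by local finiteness and
    cover [V] by connectedness. *)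
Lemma connected_countable (V : choiceType) (G : graph V) (root : V) :
  connected_graph G -> locally_finite G -> countable [set: V].
Proof.
move=> Gconn Gfin.
pose ball := fix ball n := if n is n.+1 then
  \bigcup_(x in ball n) neighbours G x else [set root].
have fin_ball n : finite_set (ball n).
  elim: n => [|n IH] /=; first exact: finite_set1.
  by apply: bigcup_finite.
have -> : [set: V] = \bigcup_(n in [set: nat]) ball n.
  apply/seteqP; split=> // x _; have [s [ps <-]] := Gconn root x.
  exists (size s) => //; elim/last_ind: s ps => [//|s y IH].
  rewrite rcons_path size_rcons last_rcons => /andP[/IH bs adj_y] /=.
  by exists (last root s).
by apply: bigcup_countable => // n _; exact: finite_set_countable.
Qed.

Section expectation_nat.
Context d (T : measurableType d) (R : realType) (P : probability T R).

Lemma expectation_nat (X : {RV P >-> nat}) :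
  ('E_P[fun w => (X w)%:R] = \sum_(0 <= i <oo) P [set w | (i < X w)%N])%E.
Proof.
have mX i : measurable [set w | (i < X w)%N].
  have -> : [set w | (i < X w)%N] = X @^-1` [set n | (i < n)%N] by [].
  by rewrite -[_ @^-1` _]setTI; exact: measurable_funP.
(* [X] is the sum over [i] of the indicators of [i < X]; all terms from index [X w] on vanish. *)
rewrite unlock; transitivity
    (\int[P]_w (\sum_(0 <= i <oo) (\1_[set w | (i < X w)%N] w)%:E))%E.
  apply: eq_integral => w _.
  rewrite (@nneseries_split _ _ 0 (X w)) //= => *; rewrite ?lee_fin ?indicE //.
  rewrite add0n eseries0 ?adde0; last first.
    by move=> i Xi _; rewrite indicE memNset //= ltnNge Xi.
  rewrite big_nat (eq_bigr (fun=> 1%:E)) ?sumEFin; last first.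
    by move=> i iX; rewrite indicE mem_set.
  by rewrite -big_nat sumr_const_nat subn0.
rewrite integral_nneseries //=; last first.
  by move=> n; apply/measurable_EFinP; exact: measurable_indic.
by apply: eq_eseriesr => i _; rewrite integral_indic // setIT.
Qed.
End expectation_nat.

(** * Walk paths, lifetime tails and independence *)

Lemma srw_path_ge0 (R : realType) (V : choiceType) (G : graph V) (x : V)
  (s : seq V) : 0 <= srw_path R G x s.
Proof.
elim: s x => [|y s IH] x //=; rewrite mulr_ge0 //.
by case: ifP => // _; rewrite invr_ge0.
Qed.

Lemma srw_path_rcons (R : realType) (V : choiceType) (G : graph V) (x y : V)
    (s : seq V) : adj G (last x s) y ->
  srw_path R G x (rcons s y) =
    srw_path R G x s * (degree G (last x s))%:R^-1.
Proof.
elim: s x => [|z s IH] x /= xy; first by rewrite xy mul1r mulr1.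
by rewrite IH // mulrA.
Qed.

(** The event avoids the values 1 to [n], whose total mass is [1 - p ^+ n]. Only these point masses
    enter, so [p = 1] needs no separate treatment. *)
Lemma lifetime_tail (R : realType) d (T : measurableType d)
    (P : probability T R) (p : R) (X : T -> \bar R) (n : nat) :
  is_lifetime P p X ->
  (P [set w | n%:R%:E < X w] <= (p ^+ n)%:E)%E.
Proof.
move=> [mX PX _]; pose A (k : nat) := [set w | X w = k.+1%:R%:E].
have mA k : measurable (A k).
  have -> : A k = X @^-1` [set k.+1%:R%:E] by [].
  by rewrite -[_ @^-1` _]setTI; exact: mX.
have tA : trivIset [set: nat] A.
  move=> i j _ _ [w []]; rewrite /A /= => -> [] /eqP.
  by rewrite -!natr1 (inj_eq (addIr _)) eqr_nat => /eqP.
have mB : measurable (\big[setU/set0]_(k < n) A k) by exact: bigsetU_measurable.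
have PB : P (\big[setU/set0]_(k < n) A k) = (1 - p ^+ n)%:E.
  rewrite measure_semi_additive_ord_I //; last exact: sub_trivIset tA.
  rewrite (eq_bigr (fun k : 'I_n => ((1 - p) * p ^+ k)%:E)); last first.
    by move=> k _; exact: (PX k.+1).
  by rewrite sumEFin -mulr_sumr -opprB mulNr -subrX1 opprB.
have mC : measurable [set w | (n%:R%:E < X w)%E].
  by rewrite -[[set _ | _]]setTI; exact: emeasurable_fun_o_infty.
apply: (@le_trans _ _ (P (~` \big[setU/set0]_(k < n) A k))).
  apply: le_measure; rewrite ?inE //; first exact: measurableC.
  move=> w /= nX; rewrite -bigcup_mkord => -[k /= kn Xk].
  by move: nX; rewrite Xk lte_fin ltr_nat ltnNge kn.
by rewrite probability_setC // PB -EFinB opprB addrCA subrr addr0.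
Qed.

Lemma independent_seq (R : realType) d (T : measurableType d)
    (P : probability T R) (I : choiceType) (F : I -> set_system T)
    (s : seq I) (E : I -> set T) :
  mutually_independent P F -> uniq s -> (forall i, i \in s -> F i (E i)) ->
  P [set w | forall i, i \in s -> E i w] = (\prod_(i <- s) fine (P (E i)))%:E.
Proof.
move=> indF us FE; have := indF [fset i in s]%fset E.
rewrite (perm_big s) /=; last first.
  by apply: uniq_perm => // i; rewrite in_fset.
move=> <-; last by move=> i; rewrite in_fset => /FE.
by congr (P _); apply/seteqP; split=> w Ew i /=; have := Ew i; rewrite /= in_fset.
Qed.

(** * Probability of a history of legs *)

Section histories.
Context (R : realType) (V : choiceType) (G : graph V) (p : R).
Context (d0 : measure_display) (T0 : measurableType d0) (P0 : probability T0 R).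
Context (eta : {RV P0 >-> nat}).
Context (d : measure_display) (T : measurableType d) (P : probability T R).
Context (F : frogs R V T).
Hypothesis p01 : 0 <= p <= 1.
Hypothesis FM : is_frog_model G p P0 eta P F.

(* A leg (x, i, s): particle i of x is awake, walks along s and is still alive
   after the last of these steps. *)
Let leg := (V * nat * seq V)%type.

Definition leg_sleeper (l : leg) := [set w | (l.1.2 < sleepers F l.1.1 w)%N].
Definition leg_walk (l : leg) := [set w | forall n, (n <= size l.2)%N ->
  walk F l.1.1 l.1.2 n w = nth l.1.1 (l.1.1 :: l.2) n].
Definition leg_alive (l : leg) :=
  [set w | ((size l.2)%:R%:E < lifetime F l.1.1 l.1.2 w)%E].

Definition leg_event (l : leg) := leg_sleeper l `&` leg_walk l `&` leg_alive l.

Definition eta_tail (i : nat) : R := fine (P0 [set w | (i < eta w)%N]).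

Definition leg_weight (l : leg) : R :=
  eta_tail l.1.2 * srw_path R G l.1.1 l.2 * p ^+ size l.2.

Definition history_event (L : seq leg) :=
  [set w | forall l, l \in L -> leg_event l w].

Definition history_weight (L : seq leg) : R := \prod_(l <- L) leg_weight l.

Lemma eta_tail_ge0 i : 0 <= eta_tail i.
Proof. exact: fine_ge0. Qed.

Lemma leg_weight_ge0 l : 0 <= leg_weight l.
Proof.
by rewrite !mulr_ge0 ?eta_tail_ge0 ?srw_path_ge0 // exprn_ge0 //; case/andP: p01.
Qed.

Lemma history_weight_ge0 L : 0 <= history_weight L.
Proof. by apply: prodr_ge0 => l _; exact: leg_weight_ge0. Qed.

Lemma measurable_sleepers x (A : set nat) : measurable (sleepers F x @^-1` A).
Proof.
have [/(_ x)[mS _] _ _ _] := FM.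
by rewrite -[_ @^-1` _]setTI; exact: mS.
Qed.

Lemma measurable_walk x i n y : measurable [set w | walk F x i n w = y].
Proof. by have [_ /(_ x i)[+ _] _ _] := FM; exact. Qed.

Lemma measurable_lifetime x i : measurable_fun [set: T] (lifetime F x i).
Proof. by have [_ _ /(_ x i)[]] := FM. Qed.

Lemma measurable_leg_walk l : measurable (leg_walk l).
Proof.
have -> : leg_walk l = \bigcap_(n in [set n | (n <= size l.2)%N])
  [set w | walk F l.1.1 l.1.2 n w = nth l.1.1 (l.1.1 :: l.2) n] by [].
by apply: bigcap_measurable; [exists 0%N|move=> n _; exact: measurable_walk].
Qed.

Lemma measurable_leg_alive l : measurable (leg_alive l).
Proof.
rewrite /leg_alive -[[set _ | _]]setTI.
by apply: emeasurable_fun_o_infty => //; exact: measurable_lifetime.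
Qed.

Lemma measurable_leg_event l : measurable (leg_event l).
Proof.
apply: measurableI; last exact: measurable_leg_alive.
apply: measurableI; last exact: measurable_leg_walk.
exact: (measurable_sleepers _ [set n | (l.1.2 < n)%N]).
Qed.

Lemma measurable_history_event L : measurable (history_event L).
Proof.
have -> : history_event L = \big[setI/setT]_(l <- L) leg_event l.
  by rewrite -bigcap_seq.
by apply: bigsetI_measurable => l _; exact: measurable_leg_event.
Qed.

Lemma frogs_sigma_leg_walk l :
  frogs_sigma F (inr (inl l.1)) (leg_walk l).
Proof.
case: l => -[x i] s /=; set B := [set B | _].
have -> : leg_walk (x, i, s) = \bigcap_(n in [set n | (n <= size s)%N])
  [set w | walk F x i n w = nth x (x :: s) n] by [].
apply: (@bigcap_measurable _ (g_sigma_algebraType B)); first by exists 0%N.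
by move=> n _; apply: sub_sigma_algebra; exists n, (nth x (x :: s) n).
Qed.

(** The random elements that a leg involves. All belong to its starting site, so legs from different
    sites share none. *)
Definition leg_index (l : leg) : seq (V + (V * nat + V * nat)) :=
  [:: inl l.1.1; inr (inl l.1); inr (inr l.1)].

Definition index_site (j : V + (V * nat + V * nat)) : V :=
  match j with inl x => x | inr (inl a) => a.1 | inr (inr a) => a.1 end.

Lemma mem_leg_index L j : j \in flatten (map leg_index L) ->
  index_site j \in [seq l.1.1 | l : leg <- L].
Proof.
move=> /flatten_mapP[l lL]; rewrite !inE => jl.
by apply/mapP; exists l => //; case/or3P: jl => /eqP ->.
Qed.

Lemma uniq_leg_index L : uniq [seq l.1.1 | l : leg <- L] ->
  uniq (flatten (map leg_index L)).
Proof.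
elim: L => [|l L IH] //= /andP[lL /IH ->].
by rewrite !inE /= andbT; apply/and3P; split;
  apply: contra lL => /mem_leg_index.
Qed.

Lemma prob_leg_sleeper l : fine (P (leg_sleeper l)) = eta_tail l.1.2.
Proof.
have [/(_ l.1.1)[_ Peta] _ _ _] := FM; congr fine.
exact: (Peta [set n | (l.1.2 < n)%N]).
Qed.

Lemma prob_leg_walk l : fine (P (leg_walk l)) = srw_path R G l.1.1 l.2.
Proof. by have [_ /(_ l.1.1 l.1.2)[_ ->] _ _] := FM. Qed.

Lemma prob_leg_alive l : fine (P (leg_alive l)) <= p ^+ size l.2.
Proof.
have [_ _ /(_ l.1.1 l.1.2) Fl _] := FM.
rewrite -lee_fin fineK; first exact: (lifetime_tail (size l.2) Fl).
by rewrite fin_num_measure //; exact: measurable_leg_alive.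
Qed.

(** Distinct starting sites make all the events involved independent; the inequality comes from the
    lifetime tails alone. *)
Lemma prob_history_event L : uniq [seq l.1.1 | l : leg <- L] ->
  (P (history_event L) <= (history_weight L)%:E)%E.
Proof.
(* Independence asks for events indexed by random elements. [look] recovers a leg of [L] from its
   starting site, which determines it by [uL]. *)
move=> uL; pose look x : leg :=
  nth (x, 0%N, [::]) L (index x [seq l.1.1 | l : leg <- L]).
have lookE l : l \in L -> look l.1.1 = l.
  move=> lL; rewrite /look.
  have iL : (index l L < size L)%N by rewrite index_mem.
  have -> : index l.1.1 [seq l.1.1 | l <- L] = index l L.
    rewrite -[RHS](@index_uniq _ l.1.1 _ [seq l.1.1 | l <- L]) ?size_map //.
    by rewrite (nth_map l) // nth_index.
  by rewrite (set_nth_default l) // nth_index.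
pose E (j : V + (V * nat + V * nat)) := match j with
  | inl x => leg_sleeper (look x)
  | inr (inl a) => leg_walk (look a.1)
  | inr (inr a) => leg_alive (look a.1) end.
have -> : history_event L =
    [set w | forall j, j \in flatten (map leg_index L) -> E j w].
  apply/seteqP; split=> w Lw.
    move=> j /flatten_mapP[l lL]; have [[lS lW] lA] := Lw l lL.
    by rewrite !inE => /or3P[] /eqP -> /=; rewrite lookE.
  move=> l lL; have LwE j : j \in leg_index l -> E j w.
    by move=> jl; apply: Lw; apply/flatten_mapP; exists l.
  have := LwE (inl l.1.1); have := LwE (inr (inl l.1)).
  have := LwE (inr (inr l.1)); rewrite /= !lookE // !inE !eqxx !orbT.
  by move=> /(_ isT) ? /(_ isT) ? /(_ isT).
have [_ _ _ indF] := FM.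
rewrite (independent_seq indF (uniq_leg_index uL)); last first.
  move=> j /flatten_mapP[l lL]; rewrite !inE => /or3P[] /eqP -> /=.
  - rewrite lookE //; exists [set n | (l.1.2 < n)%N] => //.
  - rewrite lookE //; exact: frogs_sigma_leg_walk.
  - rewrite lookE // [l.1]surjective_pairing /=.
    exists `](size l.2)%:R%:E, +oo[%classic.
      exact: emeasurable_itv.
    by apply/seteqP; split=> w; rewrite /= in_itv /= andbT.
rewrite lee_fin big_flatten big_map /history_weight.
rewrite big_seq_cond [leRHS]big_seq_cond.
apply: ler_prod => l; rewrite andbT => lL.
rewrite !big_cons big_nil /= !lookE // mulr1 mulrA.
rewrite prob_leg_sleeper prob_leg_walk.
by rewrite ?mulr_ge0 ?eta_tail_ge0 ?srw_path_ge0 ?fine_ge0 //=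
  ler_wpM2l ?mulr_ge0 ?eta_tail_ge0 ?srw_path_ge0 ?prob_leg_alive.
Qed.

End histories.

(** * Geometric decay of the probability of long ancestral paths *)

Section continuations.
Context (R : realType) (V : choiceType) (G : graph V) (p : R).
Context (d0 : measure_display) (T0 : measurableType d0) (P0 : probability T0 R).
Context (eta : {RV P0 >-> nat}).
Context (d : measure_display) (T : measurableType d) (P : probability T R).
Context (F : frogs R V T).
Hypothesis p01 : 0 <= p <= 1.
Hypothesis FM : is_frog_model G p P0 eta P F.
Hypothesis Gfin : locally_finite G.
Context (k : nat) (m : R).
Hypothesis degree_le : forall x, (degree G x <= k)%N.
Hypothesis eta_mean : (\sum_(0 <= i <oo) (eta_tail eta i)%:E = m%:E)%E.

Let leg := (V * nat * seq V)%type.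

Definition leg_end (l : leg) : V := last l.1.1 l.2.
Definition leg_step (l : leg) (y : V) : leg := (l.1, rcons l.2 y).
Definition visited (L : seq leg) : seq V :=
  flatten [seq l.1.1 :: l.2 | l : leg <- L].

(* In each time step the current particle moves to a neighbour y, and then
   either remains the one that is followed, or, if y was not visited before,
   is replaced by one of the particles of y. *)
Fixpoint continuations (n : nat) (l : leg) (L : seq leg) : set T :=
  if n is n.+1 then
    \bigcup_(y in neighbours G (leg_end l))
      (continuations n (leg_step l y) L `|`
       if y \in visited (l :: L) then set0
       else \bigcup_i continuations n (y, i, [::]) (leg_step l y :: L))
  else history_event F (l :: L).

Lemma measurable_continuations n l L : measurable (continuations n l L).
Proof.
elim: n l L => [|n IH] l L /=; first exact: (measurable_history_event FM).
apply: fin_bigcup_measurable => // y _; apply: measurableU => //.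
by case: ifP => // _; exact: bigcupT_measurable.
Qed.

Lemma mean_ge0 : 0 <= m.
Proof.
by rewrite -lee_fin -eta_mean; apply: nneseries_ge0 => *; rewrite lee_fin eta_tail_ge0.
Qed.

Lemma history_weight_step l L y : adj G (leg_end l) y ->
  history_weight G p eta (leg_step l y :: L) =
  history_weight G p eta (l :: L) * (p / (degree G (leg_end l))%:R).
Proof.
move=> ly; rewrite /history_weight !big_cons /leg_weight /=.
by rewrite size_rcons srw_path_rcons // exprSr; ring.
Qed.

Lemma history_weight_switch l L y i : adj G (leg_end l) y ->
  history_weight G p eta ((y, i, [::]) :: leg_step l y :: L) =
  eta_tail eta i * history_weight G p eta (leg_step l y :: L).
Proof. by move=> ly; rewrite /history_weight big_cons {1}/leg_weight /= !mulr1. Qed.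

(** Mean number of particles that can be followed after one step from [x], before the factor [p]:
    the walker itself, and on average [m] new ones if the neighbour it enters is unvisited. *)
Definition offspring (x : V) (L : seq leg) : R :=
  (degree G x)%:R^-1 * \sum_(y <- fset_set (neighbours G x))
    (1 + (y \notin visited L)%:R * m).

(** A union bound over the neighbour entered and the particle followed next; [b] is a common factor
    for the remaining [n] steps. *)
Lemma prob_continuations_step n l L (b : R) : 0 <= b ->
  (forall y, adj G (leg_end l) y ->
    P (continuations n (leg_step l y) L) <=
      (history_weight G p eta (leg_step l y :: L) * b)%:E)%E ->
  (forall y i, adj G (leg_end l) y -> y \notin visited (l :: L) ->
    P (continuations n (y, i, [::]) (leg_step l y :: L)) <=
      (history_weight G p eta ((y, i, [::]) :: leg_step l y :: L) * b)%:E)%E ->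
  (P (continuations n.+1 l L) <=
    (history_weight G p eta (l :: L) * (p * offspring (leg_end l) (l :: L) * b))%:E)%E.
Proof.
move=> b0 Hmove Hswitch; set w := history_weight _ _ _ (l :: L).
set x := leg_end l in Hmove Hswitch *.
(* Entering a given neighbour costs [p / degree], so [W] is common to all neighbours. *)
pose W := w * (p / (degree G x)%:R) * b.
have W0 : 0 <= W.
  by rewrite !mulr_ge0 ?history_weight_ge0 //; case/andP: p01.
have m0 := mean_ge0.
apply: (@le_trans _ _ (\sum_(y <- fset_set (neighbours G x))
    (W * (1 + (y \notin visited (l :: L))%:R * m))%:E)%E); last first.
  by rewrite sumEFin -mulr_sumr lee_fin /offspring /W le_eqVlt; apply/orP; left;
    apply/eqP; ring.
pose A y := continuations n (leg_step l y) L `|`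
    if y \in visited (l :: L) then set0
    else \bigcup_i continuations n (y, i, [::]) (leg_step l y :: L).
have mA y : measurable (A y).
  apply: measurableU; first exact: measurable_continuations.
  by case: ifP => // _; apply: bigcupT_measurable => i; exact: measurable_continuations.
apply: (@le_trans _ _ (\sum_(y \in neighbours G x) P (A y))%E).
  by apply: content_sub_fsum => //; exact: measurable_continuations.
rewrite fsbig_finite //= big_seq_cond [leRHS]big_seq_cond.
apply: lee_sum => y; rewrite andbT in_fset_set // inE => /= xy.
apply: (le_trans (measureU2 _ _ _)); first exact: measurable_continuations.
  by case: ifP => // _; apply: bigcupT_measurable => i; exact: measurable_continuations.
rewrite mulrDr mulr1 EFinD; apply: leeD.
  by have := Hmove y xy; rewrite history_weight_step.
case: ifPn => yv; first by rewrite measure0 mul0r mulr0.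
(* Switching to particle [i] costs [eta_tail eta i], and these tails add up to [m]. *)
apply: (@le_trans _ _ (\sum_(0 <= i <oo) (W%:E * (eta_tail eta i)%:E))%E); last first.
  by rewrite nneseriesZl ?eta_mean ?mul1r // => i _; rewrite lee_fin eta_tail_ge0.
apply: (@le_trans _ _ (\sum_(0 <= i <oo)
    P (continuations n (y, i, [::]) (leg_step l y :: L)))%E).
  apply: measure_sigma_subadditive => //.
    by move=> i; exact: measurable_continuations.
  by apply: bigcupT_measurable => i; exact: measurable_continuations.
apply: lee_nneseries => // i _.
have := Hswitch y i xy yv; rewrite history_weight_switch // history_weight_step //.
rewrite -EFinM -/w -/x (_ : _ * _ * b = W * eta_tail eta i) //.
by rewrite /W; ring.
Qed.

(** Times [p], this is the ratio [r] of the geometric bound. *)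
Definition mean_offspring : R := 1 + (1 - k%:R^-1) * m.

Lemma offspring_sum (s : seq V) (a : pred V) :
  \sum_(y <- s) (1 + (a y)%:R * m) = (size s)%:R + (count a s)%:R * m.
Proof.
elim: s => [|y s IH]; first by rewrite big_nil mul0r addr0.
by rewrite big_cons IH /= -natr1 natrD; ring.
Qed.

(** Counts every neighbour as unvisited. This serves for the first step, where there is no previous
    site. *)
Lemma offspring_le x L : offspring x L <= 1 + m.
Proof.
have m0 := mean_ge0.
rewrite /offspring offspring_sum; have [->|d0'] := eqVneq (degree G x) 0%N.
  by rewrite invr0 mul0r addr_ge0.
rewrite ler_pdivrMl ?ltr0n ?lt0n // mulrDr mulr1 lerD2l ler_wpM2r // ler_nat.
exact: count_size.
Qed.

(* The site from which the current one was entered contributes no particles. *)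
Lemma offspring_le_mean x v L : adj G x v -> v \in visited L ->
  offspring x L <= mean_offspring.
Proof.
move=> xv vL; have m0 := mean_ge0; set N := fset_set (neighbours G x).
have vN : v \in N by rewrite /N in_fset_set // inE.
have cN : (count (fun y => y \notin visited L) N < degree G x)%N.
  have -> : degree G x = size N by rewrite /degree cardfE.
  rewrite -(count_predC (fun y => y \notin visited L) N) -[X in (X < _)%N]addn0.
  by rewrite ltn_add2l -has_count; apply/hasP; exists v; rewrite //= vL.
have d_gt0 : 0 < (degree G x)%:R :> R by rewrite ltr0n (leq_trans _ cN).
rewrite /offspring offspring_sum ler_pdivrMl // /mean_offspring.
(* At most [degree - 1] neighbours are unvisited, and the fraction [1 - 1 / degree] increases up to
   degree [k]. *)
apply: (@le_trans _ _ ((degree G x)%:R + ((degree G x)%:R - 1) * m)).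
  rewrite lerD2l ler_wpM2r // lerBrDr natr1 ler_nat.
  exact: cN.
rewrite mulrDr mulr1 lerD2l mulrA ler_wpM2r // mulrBr mulr1 lerD2l lerN2.
by rewrite ler_pdivrMr ?mul1r ?ler_nat ?degree_le // (lt_le_trans d_gt0) // ler_nat.
Qed.

Lemma mean_offspring_ge0 : (0 < k)%N -> 0 <= mean_offspring.
Proof.
move=> k0; rewrite addr_ge0 // mulr_ge0 ?mean_ge0 // subr_ge0 invf_le1 ?ltr0n //.
by rewrite ler1n.
Qed.

(** Starting sites are visited, so an unvisited [y] differs from all of them; [leg_step] leaves them
    unchanged. *)
Lemma uniq_switch (l : leg) L y i : y \notin visited (l :: L) ->
  uniq [seq a.1.1 | a : leg <- l :: L] ->
  uniq [seq a.1.1 | a : leg <- (y, i, [::]) :: leg_step l y :: L].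
Proof.
move=> yL uL; rewrite [map _ _]/= cons_uniq [uniq _ in X in _ && X]uL andbT.
apply: contra yL => /(mapP (s := l :: L))[a aL ->].
by apply/flatten_mapP; exists a; rewrite ?mem_head.
Qed.

Lemma leg_end_visited l L : leg_end l \in visited (l :: L).
Proof. by rewrite mem_cat mem_last. Qed.

Lemma leg_end_step l y : leg_end (leg_step l y) = y.
Proof. by rewrite /leg_end last_rcons. Qed.

Lemma visited_step l L y : {subset visited (l :: L) <= visited (leg_step l y :: L)}.
Proof.
move=> z; rewrite !mem_cat /= !inE mem_rcons inE.
by case/orP => [/orP[->|->]|->]; rewrite ?orbT.
Qed.

(** The invariant is that starting sites are distinct and the current site has a visited neighbour
    [v]. After a move or a switch, the site just left takes the role of [v], so every step costs at
    most [p * mean_offspring]. *)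
Lemma prob_continuations n l L v :
  uniq [seq a.1.1 | a : leg <- l :: L] ->
  adj G (leg_end l) v -> v \in visited (l :: L) ->
  (P (continuations n l L) <=
    (history_weight G p eta (l :: L) * (p * mean_offspring) ^+ n)%:E)%E.
Proof.
elim: n l L v => [|n IH] l L v uL lv vL.
  by rewrite expr0 mulr1; exact: (prob_history_event FM uL).
have [p0 _] := andP p01.
have k0 : (0 < k)%N.
  apply: leq_trans (degree_le (leg_end l)).
  by rewrite cardfs_gt0; apply/fset0Pn; exists v; rewrite in_fset_set // inE.
have r0 := mean_offspring_ge0 k0.
apply: le_trans (prob_continuations_step (b := (p * mean_offspring) ^+ n) _ _ _) _.
- by rewrite exprn_ge0 // mulr_ge0.
- move=> y ly; apply: (IH _ _ (leg_end l)) => //.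
    by rewrite leg_end_step adj_sym.
  exact/visited_step/leg_end_visited.
- move=> y i ly yL; apply: (IH _ _ (leg_end l)); first exact: uniq_switch.
    by rewrite adj_sym.
  by rewrite inE; apply/orP; right; exact/visited_step/leg_end_visited.
rewrite lee_fin exprS ler_wpM2l ?history_weight_ge0 // ler_wpM2r ?exprn_ge0 ?mulr_ge0 //.
by rewrite ler_wpM2l // (offspring_le_mean lv).
Qed.

Lemma prob_continuations_init n x i : (0 < k)%N ->
  (P (continuations n.+1 (x, i, [::]) [::]) <=
    (eta_tail eta i * ((1 + m) * (p * mean_offspring) ^+ n))%:E)%E.
Proof.
move=> k0; have r0 := mean_offspring_ge0 k0; have [p0 p1] := andP p01.
apply: le_trans (prob_continuations_step (b := (p * mean_offspring) ^+ n) _ _ _) _.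
- by rewrite exprn_ge0 // mulr_ge0.
- move=> y ly; apply: (prob_continuations _ (v := x)) => //.
    by rewrite leg_end_step adj_sym.
  by rewrite /= !inE eqxx.
- move=> y j ly yL; apply: (prob_continuations _ (v := x)).
  + exact: uniq_switch.
  + by rewrite adj_sym.
  + by rewrite /= !inE eqxx !orbT.
rewrite lee_fin /history_weight big_seq1 /leg_weight /= !mulr1.
rewrite ler_wpM2l ?eta_tail_ge0 // ler_wpM2r ?exprn_ge0 ?mulr_ge0 //.
(* The factor [p] of the first step is bounded by 1. *)
apply: le_trans (ler_wpM2r _ p1) _; rewrite ?mul1r ?offspring_le //.
rewrite /offspring offspring_sum mulr_ge0 // addr_ge0 // mulr_ge0 //.
exact: mean_ge0.
Qed.

End continuations.

(** * Measurability of the survival event *)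

Section survival_measurable.
Context (R : realType) (V : choiceType) (G : graph V) (root : V) (p : R).
Context (d0 : measure_display) (T0 : measurableType d0) (P0 : probability T0 R).
Context (eta : {RV P0 >-> nat}).
Context (d : measure_display) (T : measurableType d) (P : probability T R).
Context (F : frogs R V T).
Hypothesis FM : is_frog_model G p P0 eta P F.
Hypothesis cV : countable [set: V].

Lemma measurable_passage x y : measurable_fun [set: T] (fun w => passage F w x y).
Proof.
pose D w := [set j : nat * nat | [/\ (j.1 < sleepers F x w)%N,
  (j.2%:R%:E < lifetime F x j.1 w)%E & walk F x j.1 j.2 w = y]].
have -> : (fun w => passage F w x y) =
    fun w => ereal_inf [set j.2%:R%:E | j in D w].
  apply/funext => w; congr ereal_inf; apply/seteqP; split=> u /=.
    by move=> [i [n [? ? ? ->]]]; exists (i, n).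
  by move=> [[i n] [? ? ?] <-]; exists i, n.
apply: (@measurable_fun_einf _ _ _ _ _ D (fun j => fun=> j.2%:R%:E)) => // j c.
have [jc|jc] := boolP (j.2%:R%:E < c%:E)%E; last first.
  by rewrite (_ : [set _ | _] = set0) // -subset0 => w [].
rewrite (_ : [set _ | _] = leg_sleeper F (x, j.1, [::]) `&`
    [set w | (j.2%:R%:E < lifetime F x j.1 w)%E] `&`
    [set w | walk F x j.1 j.2 w = y]); last first.
  by apply/seteqP; split=> w; [move=> [[]]|move=> [[]]].
apply: measurableI; last exact: (measurable_walk FM).
apply: measurableI.
  exact: (measurable_sleepers FM _ [set n | (j.1 < n)%N]).
rewrite -[[set _ | _]]setTI.
by apply: emeasurable_fun_o_infty => //; exact: (measurable_lifetime FM).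
Qed.

Lemma measurable_activation x :
  measurable_fun [set: T] (fun w => activation F root w x).
Proof.
apply: (@measurable_fun_einf _ _ _ _ (countable_seq cV)
  (fun=> [set s : seq V | last root s = x]) (fun s w => \sum_(j < size s)
    passage F w (nth root (root :: s) j) (nth root s j))%E) => s c.
have [sx|sx] := pselect (last root s = x); last first.
  by rewrite (_ : [set _ | _] = set0) // -subset0 => w [].
rewrite (_ : [set _ | _] = [set: T] `&` [set w | (\sum_(j < size s)
    passage F w (nth root (root :: s) j) (nth root s j) < c%:E)%E]); last first.
  by apply/seteqP; split=> w [].
apply: emeasurable_fun_infty_o => //.
by apply: emeasurable_sum => j; exact: measurable_passage.
Qed.

Lemma measurable_survival : measurable (survival F root).
Proof.
have -> : survival F root =
    \bigcap_n \bigcup_x \bigcup_i [set w | active F root w n x i].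
  apply/seteqP; split=> w sw n.
    by move=> _; have [x [i ?]] := sw n; exists x => //; exists i.
  by have [x _ [i _ ?]] := sw n I; exists x, i.
apply: bigcapT_measurable => n; apply: (countable_bigcupT_measurable cV) => x.
apply: bigcupT_measurable => i.
rewrite (_ : [set _ | _] = leg_sleeper F (x, i, [::]) `&`
    ([set: T] `&` [set w | (activation F root w x <= n%:R%:E)%E]) `&`
    ([set: T] `&` [set w |
      (n%:R%:E < (activation F root ^~ x \+ lifetime F x i) w)%E])); last first.
  by apply/seteqP; split=> w [] => [? ? ?|[? [_ ?]] [_ ?]].
apply: measurableI; first apply: measurableI.
- exact: (measurable_sleepers FM _ [set n | (i < n)%N]).
- by apply: emeasurable_fun_infty_c => //; exact: measurable_activation.
- apply: emeasurable_fun_o_infty => //; apply: emeasurable_funD.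
    exact: measurable_activation.
  exact: (measurable_lifetime FM).
Qed.

End survival_measurable.

(** * From an active particle to its ancestral path, for a fixed outcome *)

Section trajectories.
Context (R : realType) (V : choiceType) (G : graph V) (root : V).
Context d (T : measurableType d) (F : frogs R V T) (w : T).

Definition trajectory (x : V) (i n : nat) : seq V :=
  mkseq (fun j => walk F x i j.+1 w) n.

(** Arrival times along chains of particles. A chain may start the particles of [x] at any arrival
    time there, not only the first; the least arrival time is the activation time when walks start
    at their own sites. Steps of length 0 would not leave the site and are excluded. *)
Inductive reached : nat -> V -> Prop :=
| reached_root : reached 0 root
| reached_by t x i n : reached t x -> (i < sleepers F x w)%N ->
    (n.+1%:R%:E < lifetime F x i w)%E ->
    reached (t + n.+1) (walk F x i n.+1 w).

Definition travel_time (s : seq V) : \bar R := (\sum_(j < size s)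
  passage F w (nth root (root :: s) j) (nth root s j))%E.

Lemma travel_time_rcons s y : travel_time (rcons s y) =
  (travel_time s + passage F w (last root s) y)%E.
Proof.
rewrite /travel_time size_rcons big_ord_recr /=; congr (_ + _)%E; last first.
  by rewrite -rcons_cons nth_rcons /= ltnSn nth_last nth_rcons ltnn eqxx.
apply: eq_bigr => j _; rewrite -rcons_cons !nth_rcons /= ltn_ord.
by rewrite ltnS ltnW.
Qed.

Lemma passage_ge0 x y : (0 <= passage F w x y)%E.
Proof.
by apply: le_ereal_inf_tmp => _ [i [n [_ _ _ ->]]]; rewrite lee_fin.
Qed.

Lemma travel_time_ge0 s : (0 <= travel_time s)%E.
Proof. by apply: sume_ge0 => j _; exact: passage_ge0. Qed.

(** A finite infimum of natural numbers is a minimum. *)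
Lemma passage_attained x y : (passage F w x y < +oo)%E -> exists i n,
  [/\ (i < sleepers F x w)%N, (n%:R%:E < lifetime F x i w)%E,
      walk F x i n w = y & passage F w x y = n%:R%:E].
Proof.
move=> /ereal_inf_lt[_ [i0 [n0 [i0x n0x n0y _]]] _].
pose a n := `[< exists i, [/\ (i < sleepers F x w)%N,
  (n%:R%:E < lifetime F x i w)%E & walk F x i n w = y] >].
have ex_a : exists n, a n by exists n0; apply/asboolP; exists i0.
case: (ex_minnP ex_a) => n /asboolP[i [ix nx ny]] min_n; exists i, n; split=> //.
apply/eqP; rewrite eq_le; apply/andP; split.
  by apply: ereal_inf_lbound; exists i, n.
apply: le_ereal_inf_tmp => _ [j [l [jx lx ly ->]]].
by rewrite lee_fin ler_nat min_n //; apply/asboolP; exists j.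
Qed.

Lemma reached_activation t x : reached t x -> (activation F root w x <= t%:R%:E)%E.
Proof.
move=> tx; suff [s sx st] : exists2 s, last root s = x & (travel_time s <= t%:R%:E)%E.
  by apply: le_trans st; apply: ereal_inf_lbound; exists s.
elim: tx => {t x} [|t x i n _ [s sx st] ix nx].
  by exists [::]; rewrite // /travel_time big_ord0.
exists (rcons s (walk F x i n.+1 w)); first by rewrite last_rcons.
rewrite travel_time_rcons natrD EFinD leeD // sx.
by apply: ereal_inf_lbound; exists i, n.+1.
Qed.

Hypothesis walk0 : forall x i, walk F x i 0 w = x.

Lemma activation_reached n x : (activation F root w x <= n%:R%:E)%E ->
  exists2 t, (t <= n)%N & reached t x.
Proof.
(* A strict bound extracts a sequence of sites from the infimum; nothing is lost, since finite
   travel times are integers. *)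
move=> xn; have : (activation F root w x < n.+1%:R%:E)%E.
  by apply: le_lt_trans xn _; rewrite lte_fin ltr_nat.
move=> /ereal_inf_lt[_ [s /= <- <-]]; rewrite -/(travel_time s) {x xn}.
elim/last_ind: s n => [|s y IH] n; first by exists 0%N => //; exact: reached_root.
rewrite travel_time_rcons last_rcons => syn.
have s0 := travel_time_ge0 s.
have [i [u [ix ux uy pu]]] : exists i u, [/\ (i < sleepers F (last root s) w)%N,
    (u%:R%:E < lifetime F (last root s) i w)%E, walk F (last root s) i u w = y &
    passage F w (last root s) y = u%:R%:E].
  apply: passage_attained; apply: le_lt_trans (lt_trans syn (ltry _)).
  by rewrite leeDr.
rewrite pu in syn.
have un : (u <= n)%N.
  rewrite -ltnS -(ltr_nat R) -lte_fin; apply: le_lt_trans syn.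
  by rewrite leeDr.
have [|t tn ts] := IH (n - u)%N.
  by rewrite -subSn // natrB ?leqW // EFinB lteBrDr.
(* By [walk0], a passage of length 0 ends where it starts and adds nothing to the chain. *)
case: u => [|u] in ix ux uy pu syn un tn *.
  by exists t; [rewrite subn0 in tn|rewrite -uy walk0].
exists (t + u.+1)%N; first by rewrite -(subnK un) leq_add2r.
by rewrite -uy; exact: reached_by.
Qed.

Hypothesis walkS : forall x i n, adj G (walk F x i n w) (walk F x i n.+1 w).

Lemma size_trajectory x i n : size (trajectory x i n) = n.
Proof. exact: size_mkseq. Qed.

Lemma leg_end_trajectory x i n : leg_end (x, i, trajectory x i n) = walk F x i n w.
Proof.
rewrite /leg_end /=; case: n => [|n]; first by rewrite walk0.
by rewrite /trajectory mkseqS last_rcons.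
Qed.

Lemma leg_step_trajectory x i n :
  leg_step (x, i, trajectory x i n) (walk F x i n.+1 w) =
  (x, i, trajectory x i n.+1).
Proof. by rewrite /leg_step /trajectory mkseqS. Qed.

Lemma leg_event_trajectory x i n : (i < sleepers F x w)%N ->
  (n%:R%:E < lifetime F x i w)%E -> leg_event F (x, i, trajectory x i n) w.
Proof.
move=> ix nx; split; last by rewrite /leg_alive /= size_trajectory.
split=> // -[|j] /=; rewrite ?walk0 // size_trajectory => jn.
by rewrite nth_mkseq.
Qed.

Lemma visited_cons (l : V * nat * seq V) L z :
  (z \in visited (l :: L)) = [|| z == l.1.1, z \in l.2 | z \in visited L].
Proof. by rewrite mem_cat /= inE -orbA. Qed.

Lemma mem_trajectoryS x i n z : z \in trajectory x i n.+1 ->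
  z \in trajectory x i n \/ z = walk F x i n.+1 w.
Proof.
by rewrite /trajectory mkseqS mem_rcons inE => /orP[/eqP|]; [right|left].
Qed.

(* [L] is the line of ancestors of particle [i] of [x]. A site entered at the
   time of its first visit is fresh, so the ancestry is never cut off. *)
Lemma ancestry t x i s : reached t x -> (forall t', reached t' x -> (t <= t')%N) ->
  (i < sleepers F x w)%N -> (s%:R%:E < lifetime F x i w)%E ->
  exists L, [/\
    forall n, continuations G F n (x, i, trajectory x i s) L w ->
      exists i0, continuations G F (n + (t + s)) (root, i0, [::]) [::] w,
    history_event F ((x, i, trajectory x i s) :: L) w &
    forall z, z \in visited ((x, i, trajectory x i s) :: L) ->
      exists2 t', (t' <= t + s)%N & reached t' z].
Proof.
(* Outer induction on the first arrival time [t], inner induction on the age [s] of the particle. *)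
elim/ltn_ind: t x i s => t IHt x i s tx first_x ix.
elim: s => [|s IHs] sx; last first.
  have [|L [Lc Le Lv]] := IHs.
    by apply: lt_trans sx; rewrite lte_fin ltr_nat.
  exists L; split.
  - move=> n nL; rewrite addnS addnS -addSn; apply: (Lc n.+1) => /=.
    exists (walk F x i s.+1 w); first by rewrite /neighbours /= leg_end_trajectory.
    by left; rewrite leg_step_trajectory.
  - move=> l; rewrite inE => /orP[/eqP ->|lL]; first exact: leg_event_trajectory.
    by apply: Le; rewrite inE lL orbT.
  - move=> z; rewrite visited_cons => /or3P[/eqP zx|/mem_trajectoryS[zs|zs]|zL].
    + by exists t; rewrite ?leq_addr ?zx.
    + have [|t' t't ?] := Lv z; first by rewrite visited_cons /= zs orbT.
      by exists t' => //; rewrite (leq_trans t't) // leq_add2l.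
    + by exists (t + s.+1)%N => //; rewrite zs; exact: reached_by.
    + have [|t' t't ?] := Lv z; first by rewrite visited_cons zL !orbT.
      by exists t' => //; rewrite (leq_trans t't) // leq_add2l.
case: tx => [|t0 y j u ty jy uy] in IHt first_x ix sx *.
  exists [::]; split.
  - by move=> n ?; exists i; rewrite !addn0.
  - by move=> l; rewrite inE => /eqP ->; exact: leg_event_trajectory.
  - by move=> z; rewrite visited_cons /= orbF => /eqP ->; exists 0%N => //; exact: reached_root.
set x' := walk F y j u.+1 w in first_x ix sx *.
(* An earlier arrival at [y] would let the same particle [j] bring forward the first arrival at
   [x']. *)
have first_y t' : reached t' y -> (t0 <= t')%N.
  by move=> /reached_by/(_ jy uy)/first_x; rewrite leq_add2r.
have uy' : (u%:R%:E < lifetime F y j w)%E by apply: lt_trans uy; rewrite lte_fin ltr_nat.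
have [|L [Lc Le Lv]] := IHt t0 _ y j u ty first_y jy uy'.
  by rewrite addnS ltnS leq_addr.
(* All sites on the ancestral line were reached by time [t0 + u], one step before the first arrival
   at [x']. *)
have fresh : x' \notin visited ((y, j, trajectory y j u) :: L).
  by apply/negP => /Lv[t' t't /first_x]; rewrite leqNgt addnS ltnS t't.
exists ((y, j, trajectory y j u.+1) :: L); split.
- move=> n nL; rewrite addn0 !addnS -addSn; apply: (Lc n.+1) => /=; exists x'.
    by rewrite /neighbours /= leg_end_trajectory.
  by right; rewrite (negbTE fresh); exists i => //; rewrite leg_step_trajectory.
- move=> l; rewrite !inE => /or3P[/eqP ->|/eqP ->|lL]; try exact: leg_event_trajectory.
  by apply: Le; rewrite inE lL orbT.
- move=> z; rewrite addn0 !visited_cons in_nil orFb.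
  move=> /or4P[/eqP ->|/eqP ->|/mem_trajectoryS[zs|->]|zL].
  + by exists (t0 + u.+1)%N => //; exact: reached_by.
  + by exists t0; rewrite ?leq_addr.
  + have [|t' t't ?] := Lv z; first by rewrite visited_cons /= zs orbT.
    by exists t' => //; rewrite (leq_trans t't) // leq_add2l.
  + by exists (t0 + u.+1)%N => //; exact: reached_by.
  + have [|t' t't ?] := Lv z; first by rewrite visited_cons zL !orbT.
    by exists t' => //; rewrite (leq_trans t't) // leq_add2l.
Qed.

Lemma active_continuations n x i : active F root w n x i ->
  exists i0, continuations G F n (root, i0, [::]) [::] w.
Proof.
move=> [ix xn nx]; have [t0 t0n t0x] := activation_reached xn.
pose a t := `[< reached t x >].
have ex_a : exists t, a t by exists t0; apply/asboolP.
case: (ex_minnP ex_a) => t /asboolP tx min_t.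
have first_x t' : reached t' x -> (t <= t')%N by move=> ?; apply/min_t/asboolP.
have tn : (t <= n)%N by exact: leq_trans (first_x _ t0x) t0n.
(* The arrival time [t] is at least the activation time, so the age [n - t] is still below the
   lifetime. *)
have sx : ((n - t)%:R%:E < lifetime F x i w)%E.
  rewrite natrB // EFinB lteBlDl //.
  by apply: lt_le_trans nx _; rewrite leeD2r // reached_activation.
have [L [Lc Le _]] := ancestry tx first_x ix sx.
(* With no steps left, a continuation is just the history event. *)
by have := Lc 0%N Le; rewrite add0n subnKC.
Qed.

End trajectories.

(** * Walks almost surely start at their sites and follow edges *)

Section almost_sure.
Context (R : realType) (V : choiceType) (G : graph V) (root : V) (p : R).
Context (d0 : measure_display) (T0 : measurableType d0) (P0 : probability T0 R).
Context (eta : {RV P0 >-> nat}).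
Context (d : measure_display) (T : measurableType d) (P : probability T R).
Context (F : frogs R V T).
Hypothesis FM : is_frog_model G p P0 eta P F.
Hypothesis cV : countable [set: V].

(** The walk of the leg does not start at its site, or it follows a path of probability 0. There are
    countably many legs, so the union is null. *)
Definition irregular (l : V * nat * seq V) : set T :=
  ~` leg_walk F (l.1, [::]) `|`
  (if srw_path R G l.1.1 l.2 == 0 then leg_walk F l else set0).

Lemma measurable_irregular l : measurable (irregular l).
Proof.
apply: measurableU; first by apply: measurableC; exact: (measurable_leg_walk FM).
by case: ifP => // _; exact: (measurable_leg_walk FM).
Qed.

Lemma countable_leg : countable [set: V * nat * seq V].
Proof.
have -> : [set: V * nat * seq V] = [set: V] `*` [set: nat] `*` [set: seq V].
  by apply/seteqP; split.
by apply: countableX; [exact: countableX|exact: countable_seq].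
Qed.

Lemma prob_irregular : P (\bigcup_l irregular l) = 0%E.
Proof.
have [_ walkP _ _] := FM.
apply: (bigcup_null countable_leg measurable_irregular) => l.
apply: null_set_setU.
- by apply: measurableC; exact: (measurable_leg_walk FM).
- by case: ifP => // _; exact: (measurable_leg_walk FM).
- apply: (etrans (probability_setC P (measurable_leg_walk FM _))).
  by have [_ ->] := walkP l.1.1 l.1.2; rewrite /= subee.
- case: ifP => [/eqP s0|_]; last exact: measure0.
  by have [_ Pl] := walkP l.1.1 l.1.2; apply: (etrans (Pl l.2)); rewrite s0.
Qed.

Lemma srw_path_neq0 x s : srw_path R G x s != 0 -> path (adj G) x s.
Proof.
elim: s x => [|y s IH] x //=; case: ifP => [_|]; last by rewrite mul0r eqxx.
by rewrite mulf_eq0 negb_or => /andP[_ /IH].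
Qed.

(** A step along a non-edge would give the trajectory up to that step path probability 0, making the
    outcome irregular. *)
Lemma regular_walk w : ~ (\bigcup_l irregular l) w ->
  (forall x i, walk F x i 0 w = x) /\
  (forall x i n, adj G (walk F x i n w) (walk F x i n.+1 w)).
Proof.
move=> reg; have walk0 x i : walk F x i 0 w = x.
  apply: contrapT => w0; apply: reg; exists (x, i, [::]) => //; left.
  by move=> /(_ 0%N isT).
split=> // x i n.
have [s sE size_s] : exists2 s, s = trajectory F w x i n.+1 & size s = n.+1.
  by exists (trajectory F w x i n.+1); rewrite ?size_trajectory.
have walk_s : leg_walk F (x, i, s) w.
  move=> [|j] /=; rewrite ?walk0 // size_s => jn.
  by rewrite sE nth_mkseq.
have /srw_path_neq0/(pathP x) : srw_path R G x s != 0.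
  apply/eqP => s0; apply: reg; exists (x, i, s) => //; right.
  by rewrite /= s0 eqxx.
have wn : walk F x i n w = nth x (x :: s) n by apply: walk_s; rewrite /= size_s.
have wSn : walk F x i n.+1 w = nth x s n by apply: (walk_s n.+1); rewrite /= size_s.
by rewrite wn wSn; apply; rewrite size_s.
Qed.

Lemma survival_continuations n : survival F root `<=`
  (\bigcup_i continuations G F n (root, i, [::]) [::]) `|` \bigcup_l irregular l.
Proof.
move=> w sw; have [irr|/regular_walk[walk0 walkS]] :=
  pselect ((\bigcup_l irregular l) w); [by right|left].
have [x [i act]] := sw n.
by have [i0 ?] := active_continuations walk0 walkS act; exists i0.
Qed.

End almost_sure.

(** * Extinction below the bound and the critical parameter *)

Lemma survival_null (R : realType) (V : choiceType) (G : graph V)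
    (root : V) (k : nat) (p m : R)
    (d0 : measure_display) (T0 : measurableType d0) (P0 : probability T0 R)
    (eta : {RV P0 >-> nat})
    (d : measure_display) (T : measurableType d) (P : probability T R)
    (F : frogs R V T) :
  connected_graph G -> locally_finite G ->
  (0 < k)%N -> (forall x, (degree G x <= k)%N) ->
  ('E_P0[fun w => (eta w)%:R] = m%:E)%E ->
  0 <= p <= 1 -> is_frog_model G p P0 eta P F -> p * mean_offspring k m < 1 ->
  P (survival F root) = 0%E.
Proof.
move=> Gconn Gfin k0 degG mean p01 FM r1.
have cV := connected_countable root Gconn Gfin.
have mS := measurable_survival root FM cV.
have eta_mean : (\sum_(0 <= i <oo) (eta_tail eta i)%:E = m%:E)%E.
  rewrite -mean expectation_nat; apply: eq_eseriesr => i _.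
  rewrite fineK // fin_num_measure //.
  rewrite (_ : [set _ | _] = eta @^-1` [set n | (i < n)%N]) //.
  by rewrite -[_ @^-1` _]setTI; exact: measurable_funP.
have m0 := mean_ge0 eta_mean.
have r0 : 0 <= p * mean_offspring k m.
  by rewrite mulr_ge0 ?(mean_offspring_ge0 eta_mean) //; case/andP: p01.
(* The factor [m] sums the tails over the initial particles of the root, and [1 + m] pays for the
   first step. *)
have le_n n : (P (survival F root) <= (m * (1 + m) * (p * mean_offspring k m) ^+ n)%:E)%E.
  have mc i : measurable (continuations G F n.+1 (root, i, [::]) [::]).
    exact: (measurable_continuations FM).
  have mI := measurable_irregular FM.
  have mU : measurable (\bigcup_l irregular G F l).
    exact: countable_bigcupT_measurable (countable_leg cV) mI.
  apply: (@le_trans _ _ (P ((\bigcup_i continuations G F n.+1 (root, i, [::]) [::])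
      `|` \bigcup_l irregular G F l))).
    apply: le_measure; rewrite ?inE //; last exact: survival_continuations.
    by apply: measurableU => //; exact: bigcupT_measurable.
  rewrite measureU0 //; [|exact: bigcupT_measurable|exact: prob_irregular FM cV].
  apply: (@le_trans _ _ (\sum_(0 <= i <oo)
      P (continuations G F n.+1 (root, i, [::]) [::]))%E).
    by apply: measure_sigma_subadditive => //; exact: bigcupT_measurable.
  apply: (@le_trans _ _ (\sum_(0 <= i <oo)
      (((1 + m) * (p * mean_offspring k m) ^+ n)%:E * (eta_tail eta i)%:E))%E).
    apply: lee_nneseries => // i _; rewrite -EFinM [X in (_ <= X%:E)%E]mulrC.
    exact: (prob_continuations_init p01 FM).
  rewrite nneseriesZl; last by move=> i _; rewrite lee_fin eta_tail_ge0.
  by rewrite eta_mean -EFinM lee_fin mulrC mulrA.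
apply/eqP; rewrite -measure_le0.
have cvg0 : (m * (1 + m) * (p * mean_offspring k m) ^+ n)%:E @[n --> \oo] --> (0 : \bar R).
  apply: cvg_EFin; first by near=> n.
  rewrite -(mulr0 (m * (1 + m))); apply: cvgMr.
  by apply: cvg_expr; rewrite ger0_norm.
rewrite -(cvg_lim _ cvg0) //; apply: lime_ge; first exact: cvgP cvg0.
by near=> n.
Unshelve. all: end_near.
Qed.

Theorem proposition1p2 (R : realType) (V : choiceType) (G : graph V)
    (root : V) (k : nat)
    (d0 : measure_display) (T0 : measurableType d0) (P0 : probability T0 R)
    (eta : {RV P0 >-> nat})
    (Ginf : infinite_set [set: V])
    (Gconn : connected_graph G)
    (Gfin : locally_finite G)
    (Gk : max_degree G k)
    (eta_pos : (0 < P0 [set w | (1 <= eta w)%N])%E)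
    (eta_fin : ('E_P0[fun w => (eta w)%:R] < +oo)%E) :
  ((k%:R / (1 + (k%:R - 1) * (fine 'E_P0[fun w => (eta w)%:R] + 1)))%:E
     <= critical_parameter G root P0 eta)%E.
Proof.
have [degG _] := Gk.
(* For [k = 0] the bound is 0, below every admissible [p]. *)
have [->|k0] := posnP k.
  rewrite mul0r; apply: le_ereal_inf_tmp => _ [p [/andP[p0 _] _] <-].
  by rewrite lee_fin.
set m := fine _; have mean : ('E_P0[fun w => (eta w)%:R] = m%:E)%E.
  rewrite fineK // ge0_fin_numE //; apply: expectation_ge0 => w.
  by rewrite ler0n.
have m0 : 0 <= m by rewrite -lee_fin -mean; apply: expectation_ge0 => w; rewrite ler0n.
apply: le_ereal_inf_tmp => _ [p [p01 [d [T [P [F [FM surv]]]]]] <-].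
rewrite lee_fin leNgt; apply/negP => p_lt; move: surv.
have k1 : 1 <= k%:R :> R by rewrite ler1n.
rewrite (survival_null root Gconn Gfin k0 degG mean p01 FM) ?ltxx //.
have den0 : 0 < 1 + (k%:R - 1) * (m + 1).
  by rewrite ltr_pwDl // mulr_ge0 ?subr_ge0 // addr_ge0.
move: p_lt; rewrite ltr_pdivlMr //.
(* By this identity, [p] below the bound means [p * mean_offspring k m < 1]. *)
rewrite (_ : 1 + _ = k%:R * mean_offspring k m); last first.
  by rewrite /mean_offspring; field; rewrite gt_eqF // ltr0n.
by rewrite mulrCA -[X in _ < X]mulr1 ltr_pM2l // ltr0n.
Qed.
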